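(* For all $n\geq 3$, the $(n-1)$-dimensional permutahedron $\mathrm{conv}\{(\pi(1),\ldots,\pi(n)) : \pi \in S_n\}\subset\mathbb{R}^n$ has a facet-Hamiltonian cycle.
   Context: $S_n$ denotes the set of permutations of $[n]=\{1,\dots,n\}$. The skeleton of a polytope is the graph formed by its vertices and edges. A cycle $C$ in the skeleton of a polytope is facet-Hamiltonian if for every facet $f$ of the polytope, the intersection $f\cap C$ is nonempty and connected. Combinatorially, the edges of the permutahedron join permutations differing by one adjacent transposition, and its facets correspond to nonempty proper subsets of $[n]$. *)

(* Defs.v *)
From HB Require Import structures.
From mathcomp Require Import all_boot all_order all_algebra all_fingroup.
From mathcomp Require Import boolp classical_sets reals convex.

Set Implicit Arguments.
Unset Strict Implicit.
Unset Printing Implicit Defensive.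

Import Order.TTheory GRing.Theory Num.Theory.

Local Open Scope classical_set_scope.
Local Open Scope ring_scope.

Section Polytopes.
Variables (R : realType) (n : nat).
Implicit Types (A P F : set 'rV[R]_n) (u v : 'rV[R]_n) (C : seq 'rV[R]_n).

Definition conv_hull A : set 'rV[R]_n := smallest (@convex_set R 'rV[R]_n) A.

(* The affine hull of A is x0 + <<b>> with b linearly independent and
   x0, x0 + b_0, .., x0 + b_(k-1) points of A; the empty set has no dimension. *)
Definition has_dim A (k : nat) : Prop :=
  exists (x0 : 'rV[R]_n) (b : k.-tuple 'rV[R]_n),
    [/\ A x0, forall i, A (x0 + tnth b i), free b
      & forall x, A x -> x - x0 \in <<b>>%VS].

(* Faces are cut out by valid linear inequalities; in particular P itself is
   one (c = 0, a = 0), and so is the empty set (c = 0, a = 1). *)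
Definition is_face P F : Prop :=
  exists (c : 'cV[R]_n) (a : R),
    (forall x, P x -> (x *m c) 0 0 <= a) /\
    F = [set x | P x /\ (x *m c) 0 0 = a].

Definition is_vertex P v : Prop := is_face P [set v].

Definition is_edge P F : Prop := is_face P F /\ has_dim F 1%N.

Definition is_facet P F : Prop :=
  is_face P F /\ exists d : nat, has_dim P d.+1 /\ has_dim F d.

Definition skeleton P : rel 'rV[R]_n :=
  [rel u v | `[< [/\ is_vertex P u, is_vertex P v
                   & is_edge P (conv_hull [set u; v])] >]].

(* The sequence C lists the vertices of the cycle in cyclic order; ucycle alone
   would allow the degenerate lengths 0, 1 and 2. *)
Definition skeleton_cycle P C : Prop := (3 <= size C)%N /\ ucycle (skeleton P) C.

Definition cycle_edge C : rel 'rV[R]_n :=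
  [rel u v | [&& u \in C, v \in C & (v == next C u) || (u == next C v)]].

(* F and C intersect in the graph whose vertices are the vertices of C lying in
   F and whose edges are the edges of C contained in F. *)
Definition meet_vertex F C v : Prop := v \in C /\ F v.

Definition meet_edge F C : rel 'rV[R]_n :=
  [rel u v | cycle_edge C u v && `[< conv_hull [set u; v] `<=` F >]].

Definition meet_nonempty F C : Prop := exists v, meet_vertex F C v.

Definition meet_connected F C : Prop :=
  forall u v, meet_vertex F C u -> meet_vertex F C v ->
    exists p : seq 'rV[R]_n, path (meet_edge F C) u p /\ last u p = v.

Definition facet_hamiltonian P C : Prop :=
  skeleton_cycle P C /\
  forall F, is_facet P F -> meet_nonempty F C /\ meet_connected F C.

(* 'I_n is {0, .., n-1}, hence the successor in the coordinates. *)
Definition perm_point (s : 'S_n) : 'rV[R]_n := \row_i (s i).+1%:R.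

Definition permutahedron : set 'rV[R]_n := conv_hull (range perm_point).

End Polytopes.

(* Main.v *)
(* Read along a cycle of permutations (words) related by adjacent
   transpositions, facets are prefix sets: the facet of a proper nonempty
   subset S contains the words having S as a prefix.  Hence a closed walk is
   facet-Hamiltonian as soon as every such S is made, as a new prefix, by
   exactly one step.  Such a walk is the braid of a simple monotone Venn
   diagram, and Venn's construction adds a curve to it: the new label n+1
   follows the label n on an adjacent position, and changes sides with it after
   each crossing of n with another label, so that it cuts every region once. *)

Require Import Defs.
From mathcomp Require Import all_boot all_order all_algebra all_fingroup.
From mathcomp Require Import boolp classical_sets reals convex interval_inference.
From mathcomp Require Import ring lra zify.

Set Implicit Arguments.
Unset Strict Implicit.
Unset Printing Implicit Defensive.

Import Order.TTheory GRing.Theory Num.Theory.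

(** * Closed walks making every proper nonempty set once *)

Definition swap : Type := (seq nat * nat * nat * seq nat)%type.

Definition src (st : swap) : seq nat := let: (A, c, d, D) := st in A ++ c :: d :: D.
Definition tgt (st : swap) : seq nat := let: (A, c, d, D) := st in A ++ d :: c :: D.
Definition made (st : swap) : seq nat := let: (A, _, d, _) := st in A ++ [:: d].
Definition moves (t : nat) (st : swap) : bool :=
  let: (_, c, d, _) := st in (c == t) || (d == t).

Fixpoint walk (w : seq nat) (W : seq swap) (w' : seq nat) : bool :=
  if W is st :: W' then (src st == w) && walk (tgt st) W' w' else w == w'.

Lemma walk_cat w W1 W2 w1 w2 :
  walk w W1 w1 -> walk w1 W2 w2 -> walk w (W1 ++ W2) w2.
Proof.
elim: W1 w => [|st W1 IH] w /=; first by move/eqP->.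
by case/andP=> -> /IH h /h.
Qed.

(** Characteristic vector of a set of labels below [n], largest label first, so that adding a top
    label only adds a head. *)
Fixpoint bits (n : nat) (s : seq nat) : seq bool :=
  if n is k.+1 then (k \in s) :: bits k s else [::].

Lemma size_bits n s : size (bits n s) = n.
Proof. by elim: n => //= n ->. Qed.

Lemma mem_bits n s x : x < n -> (x \in s) \in bits n s.
Proof.
elim: n => //= n IH; rewrite ltnS leq_eqVlt inE => /orP[/eqP->|/IH->].
  by rewrite eqxx.
by rewrite orbT.
Qed.

Lemma eq_bits n s s' :
  bits n s = bits n s' <-> (forall x, x < n -> (x \in s) = (x \in s')).
Proof.
elim: n => [|n IH] /=; first by split.
split=> [[e /IH h] x|h].
  by rewrite ltnS leq_eqVlt => /orP[/eqP->//|]; apply: h.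
congr (_ :: _); first exact: h.
by apply/IH=> x lxn; apply: h; apply: ltnW.
Qed.

(** * Venn's construction on words *)

Fixpoint follow (n : nat) (b : bool) (s : seq nat) : seq nat :=
  if s is x :: s' then
    if x == n then if b then [:: n.+1, n & follow n b s'] else [:: n, n.+1 & follow n b s']
    else x :: follow n b s'
  else [::].

Lemma follow_cat n b s1 s2 : follow n b (s1 ++ s2) = follow n b s1 ++ follow n b s2.
Proof. by elim: s1 => //= x s1 ->; case: eqP => // _; case: b. Qed.

Lemma follow_id n b s : n \notin s -> follow n b s = s.
Proof.
by elim: s => //= x s IH; rewrite inE negb_or eq_sym => /andP[/negPf-> /IH->].
Qed.

Lemma mem_follow n b s x :
  (x \in follow n b s) = (x \in s) || (x == n.+1) && (n \in s).
Proof.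
elim: s => [|y s IH] /=; first by rewrite andbF.
rewrite !inE; case: (eqVneq y n) => [->|neq]; last first.
  by rewrite inE IH orbA.
by case: b IH; rewrite !inE /= => ->; case: (x == n); case: (x == n.+1); rewrite ?orbT.
Qed.

Lemma perm_follow n b s :
  perm_eq (follow n b s) (nseq (count_mem n s) n.+1 ++ s).
Proof.
apply/seq.permP=> p; elim: s => //= x s.
rewrite !count_cat !count_nseq /=.
have [->|neq] := eqVneq x n; first by case: b => /= ->; rewrite mulnDr; lia.
by move=> /= ->; rewrite add0n; lia.
Qed.

(* A crossing of [n] with another label becomes three: the follower [n.+1]
   crosses that label too, and then changes sides with [n]. *)
Definition tripled (n : nat) (b : bool) (st : swap) : seq swap :=
  let: (A, c, d, D) := st in
  let x := if b then n.+1 else n in let y := if b then n else n.+1 in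
  if c == n then [:: (A ++ [:: x], y, d, D); (A, x, d, y :: D); (A ++ [:: d], x, y, D)]
  else if d == n then [:: (A, c, x, y :: D); (A ++ [:: x], c, y, D); (A, x, y, c :: D)]
  else [:: (follow n b A, c, d, follow n b D)].

Fixpoint expand (n : nat) (b : bool) (W : seq swap) : seq swap :=
  if W is st :: W' then tripled n b st ++ expand n (b (+) moves n st) W' else [::].

Definition wf_swap (N : nat) (st : swap) : bool := perm_eq (src st) (iota 0 N).

Lemma wf_swapP N A c d D : wf_swap N (A, c, d, D) ->
  [/\ uniq (A ++ c :: d :: D) & forall x, (x \in A ++ c :: d :: D) = (x < N)].
Proof.
move=> w; split; first by rewrite (perm_uniq w) iota_uniq.
by move=> x; rewrite (perm_mem w) mem_iota.
Qed.

Lemma wf_swap_notin N x A c d D : wf_swap N (A, c, d, D) -> N <= x ->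
  [/\ x \notin A, x != c, x != d & x \notin D].
Proof.
case/wf_swapP=> _ /(_ x) e; rewrite leqNgt -e mem_cat !inE.
by rewrite !negb_or => /and4P.
Qed.

Lemma wf_swap_neq N A c d D : wf_swap N (A, c, d, D) ->
  [/\ c \notin A, d \notin A, c != d, c \notin D & d \notin D].
Proof.
case/wf_swapP; rewrite cat_uniq /= !inE !negb_or => /and3P[_ /and3P[cA dA _]].
by case/and3P=> /andP[-> ->] -> _ _; rewrite cA dA.
Qed.

Lemma perm_tgt st : perm_eq (tgt st) (src st).
Proof. by case: st => [[[A c] d] D]; apply/seq.permP=> p; rewrite !count_cat /=; lia. Qed.

Lemma walk_tripled n b st : wf_swap n.+1 st ->
  walk (follow n b (src st)) (tripled n b st) (follow n (b (+) moves n st) (tgt st)).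
Proof.
case: st => [[[A c] d] D] w /=; have [cA dA cd cD dD] := wf_swap_neq w.
have nS : n != n.+1 by rewrite neq_ltn ltnSn.
rewrite !follow_cat /=; case: (eqVneq c n) => [e|cn] /=; subst.
  rewrite [d == n]eq_sym (negPf cd) !follow_id // addbT.
  by case: b; rewrite /= -?catA /= ?eqxx.
case: (eqVneq d n) => [e|dn] /=; subst; last by rewrite addbF ?eqxx.
rewrite !follow_id // addbT.
by case: b; rewrite /= -?catA /= ?eqxx.
Qed.

Lemma wf_tripled n b st : wf_swap n.+1 st -> all (wf_swap n.+2) (tripled n b st).
Proof.
move=> w; have := w; case: st w => [[[A c] d] D] w w'.
have [cA dA cd cD dD] := wf_swap_neq w.
have key s : perm_eq s (n.+1 :: A ++ c :: d :: D) -> perm_eq s (iota 0 n.+2).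
  move=> h; apply: (perm_trans h); apply: (@perm_trans _ (n.+1 :: iota 0 n.+1)).
    by rewrite perm_cons.
  by apply/seq.permP=> p; rewrite -[in RHS]addn1 iotaD count_cat /= add0n; lia.
rewrite /tripled; case: (eqVneq c n) => [e|cn]; subst.
  by case: b; rewrite /= /wf_swap /src !andbT; apply/and3P; split; apply: key;
     apply/seq.permP=> p; rewrite -?catA /= !count_cat /= ?count_cat /=; lia.
case: (eqVneq d n) => [e|dn]; subst.
  by case: b; rewrite /= /wf_swap /src !andbT; apply/and3P; split; apply: key;
     apply/seq.permP=> p; rewrite -?catA /= !count_cat /= ?count_cat /=; lia.
rewrite /= andbT; apply: key; have [u m] := wf_swapP w.
have -> : src (follow n b A, c, d, follow n b D) = follow n b (A ++ c :: d :: D).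
  by rewrite follow_cat /= (negPf cn) (negPf dn).
by apply: (perm_trans (perm_follow _ _ _)); rewrite count_uniq_mem // m ltnSn.
Qed.

Definition makes (N : nat) (X : seq bool) (st : swap) : bool := bits N (made st) == X.

(** If [n] does not cross, its follower lies on the same side of the crossing, so the set made
    contains both labels or neither. Otherwise the three steps make one set on which the two labels
    agree, extending the old one, and one set for each way of separating them. The follower moves in
    exactly two of these steps, one making a set without [n] and one a set with [n]. *)
Lemma count_makes_tripled n b st X : wf_swap n.+1 st ->
  let N a a' := count (makes n.+2 [:: a, a' & X]) (tripled n b st) in
  let T a a' := count (predI (moves n.+1) (makes n.+2 [:: a, a' & X])) (tripled n b st) in
  let t := (moves n st && makes n.+1 (false :: X) st) +
           (moves n st && makes n.+1 (true :: X) st) in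
  [/\ N false false = makes n.+1 (false :: X) st, N true true = makes n.+1 (true :: X) st,
      N true false = t & N false true = t] /\
  (T false false + T true false = t /\ T false true + T true true = t).
Proof.
case: st => [[[A c] d] D] w.
have [nA nc nd nD] := wf_swap_notin w (leqnn _).
have [cA dA cd cD dD] := wf_swap_neq w.
have nS : n != n.+1 by rewrite neq_ltn ltnSn.
have nltn x : x < n -> (x == n) = false /\ (x == n.+1) = false by lia.
have sn : (n.+1 == n) = false by lia.
rewrite /tripled; case: (eqVneq c n) => [e|cn]; subst.
  (* [bits n] does not see [n] and [n.+1], so the sets made differ only in their two leading
     bits. *)
  have low : [/\ bits n ((A ++ [:: n.+1]) ++ [:: d]) = bits n (A ++ [:: d]),
      bits n ((A ++ [:: n]) ++ [:: d]) = bits n (A ++ [:: d]),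
      bits n ((A ++ [:: d]) ++ [:: n]) = bits n (A ++ [:: d])
    & bits n ((A ++ [:: d]) ++ [:: n.+1]) = bits n (A ++ [:: d])].
    by split; apply/eq_bits => x /nltn[xn xS];
      rewrite !mem_cat !inE ?xn ?xS ?orbF ?orFb.
  have [l1 l2 l3 l4] := low.
  have dn : (d == n) = false by rewrite eq_sym (negPf cd).
  have dS : (d == n.+1) = false by rewrite eq_sym (negPf nd).
  by case: b; rewrite /= /makes /= /moves !mem_cat !inE ?(negPf cA) ?(negPf nA)
    ?(negPf nS) ?sn ?(negPf nd) ?(negPf cd) ?dn ?dS
    ?l1 ?l2 ?l3 ?l4 ?eqxx /= ?eqseq_cons /=; case: (_ == X).
case: (eqVneq d n) => [e|dn]; subst => //.
  have low : [/\ bits n ((A ++ [:: n.+1]) ++ [:: n]) = bits n A,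
      bits n ((A ++ [:: n]) ++ [:: n.+1]) = bits n A,
      bits n (A ++ [:: n]) = bits n A
    & bits n (A ++ [:: n.+1]) = bits n A].
    by split; apply/eq_bits => x /nltn[xn xS];
      rewrite !mem_cat !inE ?xn ?xS ?orbF ?orFb.
  have [l1 l2 l3 l4] := low.
  have cn' : (c == n) = false by rewrite (negPf cd).
  have cS : (c == n.+1) = false by rewrite eq_sym (negPf nc).
  by case: b; rewrite /= /makes /= /moves !mem_cat !inE ?(negPf dA) ?(negPf nA)
    ?(negPf nS) ?sn ?(negPf nc) ?cS ?cn'
    ?l1 ?l2 ?l3 ?l4 ?eqxx /= ?eqseq_cons /=; case: (_ == X).
rewrite /= /makes /= /moves !mem_cat !inE !mem_follow (negPf cn) (negPf dn).
have -> : bits n (follow n b A ++ [:: d]) = bits n (A ++ [:: d]).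
  by apply/eq_bits=> x /nltn[xn xS]; rewrite !mem_cat mem_follow xS orbF.
rewrite [d == _]eq_sym [c == _]eq_sym (negPf nc) (negPf nd) (negPf nA) ?sn ?(negPf nS) ?eqxx.
rewrite ?eqseq_cons /= [n == d]eq_sym (negPf dn) !orbF.
by case: (n \in A); case: (_ == X).
Qed.

Lemma count_moves_tripled n b st : wf_swap n.+1 st ->
  count (moves n.+1) (tripled n b st) = (moves n st).*2.
Proof.
case: st => [[[A c] d] D] w.
have [_ nc nd _] := wf_swap_notin w (leqnn _).
have [_ _ cd _ _] := wf_swap_neq w.
have sn : (n == n.+1) = false by lia.
rewrite /tripled /=; case: (eqVneq c n) => [e|cn]; subst.
  by case: b; rewrite /= !eqxx ?sn 1?[d == n.+1]eq_sym (negPf nd) ?orbT.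
case: (eqVneq d n) => [e|dn]; subst.
  by case: b; rewrite /= !eqxx ?sn 1?[c == n.+1]eq_sym (negPf nc) ?orbT.
by rewrite /= [c == _]eq_sym [d == _]eq_sym (negPf nc) (negPf nd).
Qed.

Lemma walk_expand n b w W w' : all (wf_swap n.+1) W -> walk w W w' ->
  walk (follow n b w) (expand n b W) (follow n (b (+) odd (count (moves n) W)) w').
Proof.
elim: W b w => [|st W IH] b w /=; first by move=> _ /eqP->; rewrite addbF.
case/andP=> wst wW /andP[/eqP<- h].
apply: (walk_cat (walk_tripled b wst)).
by rewrite oddD oddb addbA; apply: IH.
Qed.

Lemma all_expand n b W : all (wf_swap n.+1) W -> all (wf_swap n.+2) (expand n b W).
Proof.
elim: W b => [|st W IH] b //= /andP[wst wW].
by rewrite all_cat wf_tripled // IH.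
Qed.

Lemma count_moves_expand n b W : all (wf_swap n.+1) W ->
  count (moves n.+1) (expand n b W) = (count (moves n) W).*2.
Proof.
elim: W b => [|st W IH] b //= /andP[wst wW].
by rewrite count_cat count_moves_tripled // IH // doubleD.
Qed.

Lemma size_expand n b W : size W + (count (moves n) W).*2 <= size (expand n b W).
Proof.
elim: W b => [|st W IH] b //=; rewrite size_cat.
have := IH (b (+) moves n st); case: st => [[[A c] d] D] /=.
by case: (c == n); case: (d == n) => /=; lia.
Qed.

Lemma count_makes_expand n b W X : all (wf_swap n.+1) W ->
  let N a a' := count (makes n.+2 [:: a, a' & X]) (expand n b W) in
  let T a a' := count (predI (moves n.+1) (makes n.+2 [:: a, a' & X])) (expand n b W) in
  let t := count (predI (moves n) (makes n.+1 (false :: X))) W +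
           count (predI (moves n) (makes n.+1 (true :: X))) W in
  [/\ N false false = count (makes n.+1 (false :: X)) W,
      N true true = count (makes n.+1 (true :: X)) W,
      N true false = t & N false true = t] /\
  (T false false + T true false = t /\ T false true + T true true = t).
Proof.
elim: W b => [|st W IH] b //= /andP[wst wW].
have [[a1 a2 a3 a4] [a5 a6]] := count_makes_tripled b X wst.
have [[b1 b2 b3 b4] [b5 b6]] := IH (b (+) moves n st) wW.
by rewrite !count_cat a1 a2 a3 a4 b1 b2 b3 b4; do ![split] => //; lia.
Qed.

(* The last conjunct says that the curve of the top label meets every region
   of the diagram formed by the other labels exactly once. *)
Definition full_cycle n (w : seq nat) (W : seq swap) : Prop :=
  [/\ walk w W w, all (wf_swap n.+2) W, ~~ odd (count (moves n.+1) W),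
      forall X, size X = n.+2 ->
        count (makes n.+2 X) W = ((true \in X) && (false \in X)) :> nat
    & forall X, size X = n.+1 ->
        count (predI (moves n.+1) (makes n.+2 (false :: X))) W +
        count (predI (moves n.+1) (makes n.+2 (true :: X))) W = 1].

Lemma full_cycle_base :
  full_cycle 0 [:: 0; 1] [:: ([::], 0, 1, [::]); ([::], 1, 0, [::])].
Proof.
split=> //; first by case=> [|[] [|[] []]].
by case=> [|[] []].
Qed.

(** An even number of crossings brings the follower back to its initial side, which closes the new
    walk. A set on which the old top label and its follower agree is counted by the fourth conjunct
    for [W]; a set separating them, by the last one. *)
Lemma full_cycle_expand n w W : full_cycle n w W ->
  full_cycle n.+1 (follow n.+1 true w) (expand n.+1 true W).
Proof.
case=> wW wf even cnt top; split.
- by have := walk_expand true wf wW; rewrite (negPf even) addbF.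
- exact: all_expand.
- by rewrite count_moves_expand // odd_double.
- case=> [|a [|a' X]] //= [sX].
  have [[b1 b2 b3 b4] _] := count_makes_expand true X wf.
  have tX := top X sX.
  case: a a' => -[]; rewrite ?b1 ?b2 ?b3 ?b4 ?tX ?cnt /= ?sX // !inE ?orbT //=.
- case=> [|a X] //= [sX].
  have [_ [b5 b6]] := count_makes_expand true X wf.
  by case: a; rewrite ?b5 ?b6 top.
Qed.

Lemma full_cycle_exists n : exists w W, full_cycle n w W /\ n.+2 <= size W.
Proof.
elim: n => [|n [w [W [h sW]]]].
  by exists [:: 0; 1], [:: ([::], 0, 1, [::]); ([::], 1, 0, [::])]; split=> //; exact: full_cycle_base.
exists (follow n.+1 true w), (expand n.+1 true W); split; first exact: full_cycle_expand.
apply: leq_trans (size_expand _ _ _).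
(* The set is arbitrary: the last conjunct yields a step moving the top label, so the expansion has
   at least two steps more than [W]. *)
have [_ _ _ _ /(_ (nseq n.+1 true))] := h; rewrite size_nseq => /(_ erefl) e.
have le_moves p : count (predI (moves n.+1) p) W <= count (moves n.+1) W.
  by apply: sub_count => st /andP[].
move: e (le_moves (makes n.+2 (false :: nseq n.+1 true)))
  (le_moves (makes n.+2 (true :: nseq n.+1 true))) sW.
lia.
Qed.

(** * Distinctness of the words along a full cycle *)

Lemma walk_split w W1 W2 w' : walk w (W1 ++ W2) w' ->
  walk w W1 (last w (map tgt W1)) && walk (last w (map tgt W1)) W2 w'.
Proof. by elim: W1 w => [|st W1 IH] w /=; [rewrite eqxx | case/andP=> -> /IH]. Qed.

Lemma wf_made N st : wf_swap N st ->
  [/\ uniq (made st), forall x, x \in made st -> x < N & 0 < size (made st) < N].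
Proof.
case: st => [[[A c] d] D] w; have [u m] := wf_swapP w; have [_ dA _ _ _] := wf_swap_neq w.
split.
- by move: u; rewrite !cat_uniq /= orbF dA => /and3P[-> _ _].
- by move=> x; rewrite -m /= !mem_cat !inE => /orP[->|->]; rewrite ?orbT.
- have := perm_size w; rewrite size_iota !size_cat /=; lia.
Qed.

Lemma eq_bits_size N s s' : uniq s -> uniq s' ->
  (forall x, x \in s -> x < N) -> (forall x, x \in s' -> x < N) ->
  bits N s = bits N s' -> size s = size s'.
Proof.
move=> u u' b b' /eq_bits e; apply/perm_size/uniq_perm => // x.
case: (ltnP x N) => [/e //|le]; apply/idP/idP => [/b|/b']; lia.
Qed.

(** A step changes, as a set, only the prefix ending between the two exchanged letters; its length
    [size (made st)] is the level of the step. *)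
Lemma mem_take_tgt k st x : size (made st) != k ->
  (x \in take k (tgt st)) = (x \in take k (src st)).
Proof.
case: st => [[[A c] d] D]; rewrite /= size_cat /= => ne.
rewrite !take_cat; case: ltnP => // le.
have : k - size A != 1 by lia.
case: (k - size A) => [|[|j]] //= _.
by rewrite !mem_cat !inE; case: (x \in A); case: (x == c); case: (x == d).
Qed.

Lemma take_tgt st : take (size (made st)) (tgt st) = made st.
Proof.
case: st => [[[A c] d] D] /=.
by rewrite -[d :: c :: D]/([:: d] ++ c :: D) catA take_size_cat.
Qed.

Lemma mem_take_walk k w W w' x : walk w W w' ->
  all (fun st => size (made st) != k) W -> (x \in take k w') = (x \in take k w).
Proof.
elim: W w => [|st W IH] w /=; first by move/eqP->.
by case/andP=> /eqP<- h /andP[ne al]; rewrite (IH _ h) // mem_take_tgt.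
Qed.

(** After the last step at level [k] the first [k] labels no longer change as a set, so that step
    makes the prefix set of the final word [v]. *)
Lemma closed_makes N k v W w : walk w W v -> has (fun st => size (made st) == k) W ->
  has (makes N (bits N (take k v))) W.
Proof.
elim: W w => [|st W IH] w //= /andP[_ h].
case: (boolP (has _ W)) => [hW _|nW]; first by rewrite (IH _ h hW) orbT.
rewrite orbF => /eqP e; apply/orP; left; apply/eqP/eq_bits => x _.
by rewrite (mem_take_walk x h) -?e ?take_tgt // e all_predC.
Qed.

Lemma full_cycle_level n w W : full_cycle n w W -> forall X,
  size X = n.+2 -> (true \in X) && (false \in X) -> has (makes n.+2 X) W.
Proof.
by case=> _ _ _ cnt _ X sX pX; rewrite has_count cnt // pX.
Qed.

Lemma not_both (p : pred swap) (W1 W2 : seq swap) (b : bool) :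
  has p W1 -> has p W2 -> count p W1 + count p W2 = b -> False.
Proof. by rewrite !has_count; case: b; lia. Qed.

(* Each set is made only once, so no level is active in both [W1] and [W2].  If
   [W2] is inactive at level [k] but active at level [k+1], then every set of
   size [k+1] is made in [W2] and contains the fixed prefix of length [k]. *)
Lemma closed_subwalk n v W1 W2 :
  walk v W1 v -> walk v W2 v -> perm_eq v (iota 0 n.+2) ->
  all (wf_swap n.+2) (W1 ++ W2) ->
  (forall X, size X = n.+2 ->
    count (makes n.+2 X) (W1 ++ W2) = ((true \in X) && (false \in X)) :> nat) ->
  ~~ has (fun st => size (made st) == 1) W2 -> W2 = [::].
Proof.
move=> c1 c2 pv wf cnt no1.
have uv : uniq v by rewrite (perm_uniq pv) iota_uniq.
have sv : size v = n.+2 by rewrite (perm_size pv) size_iota.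
have bv x : x \in v -> x < n.+2 by rewrite (perm_mem pv) mem_iota.
have once k : ~~ (has (fun st => size (made st) == k) W1 &&
                  has (fun st => size (made st) == k) W2).
  apply/negP=> /andP[/(closed_makes n.+2 c1) h1 /(closed_makes n.+2 c2) h2].
  have := cnt (bits n.+2 (take k v)) (size_bits _ _); rewrite count_cat; move: h1 h2.
  exact: not_both.
have none k : 0 < k < n.+2 -> ~~ has (fun st => size (made st) == k) W2.
  elim: k => // -[//|k] IH lk; apply/negP=> h2.
  have nk : all (fun st => size (made st) != k.+1) W2 by rewrite all_predC IH //; lia.
  have n1 : ~~ has (fun st => size (made st) == k.+2) W1.
    by have := once k.+2; rewrite h2 andbT.
  case: v uv sv bv c2 {c1 once pv} => [//|a v] uv sv bv c2.
  (* [v] now denotes the word without its first label [a]. Thus [X] omits [a], whereas [a] stays in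
     the prefix of length [k.+1], which [W2] leaves fixed as a set. *)
  pose X := bits n.+2 (take k.+2 v).
  have av : a \notin take k.+2 v by move: uv => /= /andP[+ _]; apply: contraNN => /mem_take.
  have : has (makes n.+2 X) (W1 ++ W2).
    rewrite has_count cnt ?size_bits //.
    have h : head 0 v \in take k.+2 v by case: v sv {X uv bv c2 av} => [|y v] //= _; rewrite mem_head.
    have hv : head 0 v < n.+2 by apply: bv; rewrite inE (mem_take h) orbT.
    have -> : true \in X by rewrite -h; exact: mem_bits.
    have -> // : false \in X by rewrite -(negPf av); apply/mem_bits/bv/mem_head.
  case/hasP=> st stW /eqP e; have [um bm _] := wf_made (allP wf _ stW).
  have sm : size (made st) = k.+2.
    rewrite (eq_bits_size um _ bm _ e) ?size_takel //; first by move: sv lk => /= [->].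
      by move: uv => /= /andP[_ uv]; exact: take_uniq.
    by move=> x /mem_take xv; apply: bv; rewrite inE xv orbT.
  have nam : a \notin made st.
    by move/eq_bits: e => /(_ a (bv _ (mem_head _ _))); rewrite (negPf av) => ->.
  move: stW; rewrite mem_cat => /orP[stW|stW].
    by move/hasPn: n1 => /(_ _ stW); rewrite sm eqxx.
  case/splitPr: stW nk c2 => W3 W4; rewrite -cat_rcons all_cat => /andP[nk _].
  case/walk_split/andP => /mem_take_walk/(_ nk) e3 _.
  move: e3 => /(_ a); rewrite map_rcons last_rcons mem_head.
  rewrite -(take_takel _ (leqnSn k.+1)) -sm take_tgt => /mem_take.
  by rewrite (negPf nam).
apply/eqP; rewrite -size_eq0; case: W2 wf none {cnt c2 no1 once} => // st W2.
rewrite all_cat /= => /and3P[_ /wf_made[_ _ lt] _] /(_ _ lt) /=.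
by rewrite eqxx.
Qed.

(** A repeated word [v] would cut the cycle into two nonempty closed walks based at [v]. They cannot
    both be active at level 1, and one inactive there is empty by [closed_subwalk]. *)
Lemma full_cycle_uniq n w W : full_cycle n w W -> perm_eq w (iota 0 n.+2) ->
  uniq (map tgt W).
Proof.
case=> wW wf _ cnt _ pw; apply/negPn/negP => /(uniqPn [::])[i [j [lij]]].
rewrite size_map => ljW e.
pose st := nth ([::], 0, 0, [::]) W.
(* The steps of index [i.+1] to [j], and those of index [j.+1] around the cycle to [i]. *)
pose W1 := take (j - i) (drop i.+1 W); pose W2 := drop j.+1 W ++ take i.+1 W.
have eW : W = take i.+1 W ++ (W1 ++ drop j.+1 W).
  by rewrite -{1}(cat_take_drop i.+1 W) -{1}(cat_take_drop (j - i) (drop i.+1 W))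
     drop_drop; congr (_ ++ (_ ++ drop _ _)); lia.
have lasti k : k < size W -> last w (map tgt (take k.+1 W)) = nth [::] (map tgt W) k.
  move=> lk; rewrite -nth_last size_map size_takel // map_take nth_take //.
  by rewrite (set_nth_default [::]) ?size_map.
have eW' : take j.+1 W = take i.+1 W ++ W1.
  by rewrite {1}(_ : j.+1 = i.+1 + (j - i)) ?takeD //; lia.
have := wW; rewrite {1}eW => /walk_split/andP[w1 /walk_split/andP[w2 w3]].
move: w1 w2 w3; rewrite -last_cat -map_cat -eW' !lasti //; last exact: ltn_trans ljW.
rewrite -e; set v := nth _ _ i => w1 w2 w3.
have w4 : walk v W2 v by exact: walk_cat w3 w1.
have pW : perm_eq (W1 ++ W2) W.
  by rewrite [X in perm_eq _ X]eW /W2 catA perm_catC.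
have wf' : all (wf_swap n.+2) (W1 ++ W2) by rewrite (perm_all _ pW).
have pv : perm_eq v (iota 0 n.+2).
  have lti : i < size W by exact: ltn_trans ljW.
  rewrite /v (nth_map ([::], 0, 0, [::])) //.
  by apply: (perm_trans (perm_tgt _)); apply: (allP wf); exact: mem_nth.
have cnt' X : size X = n.+2 ->
    count (makes n.+2 X) (W1 ++ W2) = ((true \in X) && (false \in X)) :> nat.
  by move=> sX; rewrite (seq.permP pW) cnt.
have s1 : 0 < size W1.
  by rewrite size_takel ?subn_gt0 // size_drop -(subSS i j) leq_sub2r.
have s2 : 0 < size W2 by rewrite size_cat size_takel ?addnS // (ltn_trans lij).
have [h2|no] := boolP (has (fun st => size (made st) == 1) W2); last first.
  by have := closed_subwalk w2 w4 pv wf' cnt' no => W20; rewrite W20 in s2.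
suff W10 : W1 = [::] by rewrite W10 in s1.
apply: (closed_subwalk w4 w2 pv).
- by rewrite all_cat andbC -all_cat.
- by move=> X sX; rewrite count_cat addnC -count_cat cnt'.
(* If both were active at level 1, each would make the singleton of the first label of [v]. *)
- apply/negP=> h1.
  have := cnt' (bits n.+2 (take 1 v)) (size_bits _ _); rewrite count_cat.
  move: (closed_makes n.+2 w2 h1) (closed_makes n.+2 w4 h2).
  exact: not_both.
Qed.

(** * Vertices, edges and facets of the permutahedron *)

Section Convexity.
Local Open Scope classical_set_scope.
Local Open Scope ring_scope.
Variables (R : realType) (n : nat).
Implicit Types (A B : set 'rV[R]_n) (x y : 'rV[R]_n) (c : 'cV[R]_n).

Lemma convex_setP A : @convex_set R 'rV[R]_n A <->
  (forall x y (t : R), A x -> A y -> 0 < t -> t < 1 -> A (t *: x + (1 - t) *: y)).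
Proof.
split=> [h x y t Ax Ay t0 t1|h].
  have t01 : Itv.spec (@Itv.num_sem R) (Itv.Real `[0%Z, 1%Z]) t.
    by rewrite /= /Itv.num_sem /= in_itv /= num_real !ltW.
  have := h x y (Itv.mk t01); rewrite !inE => /(_ Ax Ay).
  by [].
apply/convex_setW => x y; rewrite !inE => Ax Ay t t0 t1.
by rewrite inE; exact: h.
Qed.

Lemma subset_conv_hull A : A `<=` conv_hull A.
Proof. exact: sub_gen_smallest. Qed.

Lemma convex_conv_hull A : @convex_set R 'rV[R]_n (conv_hull A).
Proof.
by apply/convex_setP => x y t Ax Ay t0 t1 B [cB AB]; apply: (convex_setP B).1 => //;
  [apply: Ax|apply: Ay].
Qed.

Lemma conv_hull_min A B : @convex_set R 'rV[R]_n B -> A `<=` B -> conv_hull A `<=` B.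
Proof. by move=> cB AB; exact: smallest_sub. Qed.

Lemma dotD (t : R) x y c : ((t *: x + (1 - t) *: y) *m c) 0 0 =
  t * (x *m c) 0 0 + (1 - t) * (y *m c) 0 0.
Proof. by rewrite mulmxDl -!scalemxAl !mxE. Qed.

Lemma conv_hull_le A c a : (forall x, A x -> (x *m c) 0 0 <= a) ->
  forall x, conv_hull A x -> (x *m c) 0 0 <= a.
Proof.
move=> h x; move: x; apply: (@conv_hull_min A [set x | (x *m c) 0 0 <= a]) => //.
apply/convex_setP => x y t /= hx hy t0 t1; rewrite dotD; nra.
Qed.

Lemma conv_hull_eq A c a : (forall x, A x -> (x *m c) 0 0 = a) ->
  forall x, conv_hull A x -> (x *m c) 0 0 = a.
Proof.
move=> h x; move: x; apply: (@conv_hull_min A [set x | (x *m c) 0 0 = a]) => //.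
by apply/convex_setP => x y t /= hx hy t0 t1; rewrite dotD hx hy; ring.
Qed.

(** The bound and the implication together define a convex set: a proper convex combination reaches
    the maximum [a] only if both of its ends do. *)
Lemma conv_hull_face A B c a : @convex_set R 'rV[R]_n B ->
  (forall x, A x -> (x *m c) 0 0 <= a /\ ((x *m c) 0 0 = a -> B x)) ->
  forall x, conv_hull A x -> (x *m c) 0 0 = a -> B x.
Proof.
move=> cB h x hx.
suff : [set x | (x *m c) 0 0 <= a /\ ((x *m c) 0 0 = a -> B x)] x by case.
move: x hx; apply: conv_hull_min; last exact: h.
apply/convex_setP => x y t /= [xa xB] [ya yB] t0 t1; rewrite dotD; split; first nra.
by move=> e; apply: (convex_setP B).1 => //; [apply: xB|apply: yB]; nra.
Qed.

Lemma is_face_convex A F : @convex_set R 'rV[R]_n A -> is_face A F ->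
  @convex_set R 'rV[R]_n F.
Proof.
move=> cA [c [a [_ ->]]]; apply/convex_setP => x y t /= [Ax xa] [Ay ya] t0 t1.
by split; [exact: (convex_setP A).1|rewrite dotD xa ya; ring].
Qed.

End Convexity.

(** * Dimension and facets *)

Section Faces.
Local Open Scope classical_set_scope.
Local Open Scope ring_scope.
Variables (R : realType) (n : nat).
Implicit Types (P F : set 'rV[R]_n) (x y : 'rV[R]_n) (c g : 'cV[R]_n).

Lemma mem_lker_dot c x :
  (x \in lker (linfun (mulmxr c))) = ((x *m c) 0 0 == 0).
Proof.
rewrite memv_ker lfunE /=; apply/eqP/eqP=> [->|e]; first by rewrite mxE.
by apply/matrixP=> i j; rewrite !ord1 e mxE.
Qed.

Lemma dotB x y c : ((x - y) *m c) 0 0 = (x *m c) 0 0 - (y *m c) 0 0.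
Proof. by rewrite mulmxBl !mxE. Qed.

Lemma has_dim_mono P F d e : has_dim P d -> has_dim F e -> P `<=` F -> (d <= e)%N.
Proof.
move=> [y0 [b [Py Pb fb _]]] [x0 [b' [_ _ fb' Fs]]] PF.
move: fb fb'; rewrite /free !size_tuple => /eqP <- /eqP <-.
apply/dimvS/span_subvP => v /tnthP[i ->].
have -> : tnth b i = (y0 + tnth b i - x0) - (y0 - x0).
  by rewrite opprB addrA subrK addrAC subrr add0r.
by apply: rpredB; apply/Fs/PF.
Qed.

(* [F] and its superset [P] cut by [g = m] are both of codimension one, so
   they have the same affine hull. *)
Lemma facet_maximal P F c a g m d :
  F = [set x | P x /\ (x *m c) 0 0 = a] -> has_dim P d.+1 -> has_dim F d ->
  (forall x, F x -> (x *m g) 0 0 = m) -> (exists2 y, P y & (y *m g) 0 0 != m) ->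
  forall y, P y -> (y *m g) 0 0 = m -> F y.
Proof.
move=> defF [y0 [b [Py Pb fb Ps]]] [x0 [b' [Fx Fb fb' Fs]]] Fg [z Pz zg] y Py' yg.
have PF x : F x -> P x by rewrite defF => -[].
have sub x : P x -> x - x0 \in <<b>>%VS.
  move=> Px; have -> : x - x0 = (x - y0) - (x0 - y0) by rewrite opprB addrA subrK.
  by apply: rpredB; apply: Ps => //; exact: PF.
pose K := (<<b>> :&: lker (linfun (mulmxr g)))%VS.
have FK : (<<b'>> <= K)%VS.
  apply/span_subvP=> v /tnthP[i ->]; rewrite memv_cap mem_lker_dot.
  have := sub _ (PF _ (Fb i)); rewrite addrAC subrr add0r => -> /=.
  by rewrite -[tnth b' i](addKr x0) addrC dotB !Fg ?subrr.
have KP : (K <= <<b>>)%VS by exact: capvSl.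
have neK : K != <<b>>%VS.
  apply/eqP=> eK; have := sub _ Pz; rewrite -eK memv_cap mem_lker_dot dotB.
  by rewrite (Fg _ Fx) subr_eq0 (negPf zg) andbF.
move: fb fb'; rewrite /free !size_tuple => /eqP db /eqP db'.
have eK : (<<b'>> == K)%VS.
  rewrite eqEdim FK /= db' -ltnS -db ltn_neqAle dimvS // andbT.
  by apply: contraNneq neK => e; rewrite eqEdim KP e /=.
have : y - x0 \in <<b'>>%VS.
  by rewrite (eqP eK) memv_cap sub //= mem_lker_dot dotB yg Fg ?subrr.
have : (<<b'>> <= lker (linfun (mulmxr c)))%VS.
  apply/span_subvP=> v /tnthP[i ->]; rewrite mem_lker_dot.
  rewrite -[tnth b' i](addKr x0) addrC dotB.
  by move: (Fb i) Fx; rewrite defF => -[_ ->] [_ ->]; rewrite subrr.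
move=> /subvP h /h; rewrite mem_lker_dot dotB.
by move: Fx; rewrite defF => -[_ ->]; rewrite subr_eq0 => /eqP; split.
Qed.

End Faces.

(** * Faces of the permutahedron *)

Section Permutahedron.
Local Open Scope classical_set_scope.
Local Open Scope ring_scope.
Variables (R : realType) (n : nat).
Implicit Types (s u v : 'S_n) (T : {set 'I_n}).

Local Notation P := (@permutahedron R n).
Local Notation pt := (perm_point R).

Lemma perm_point_in s : P (pt s).
Proof. by apply: subset_conv_hull; exists s. Qed.

Lemma dot_perm_point s (c : 'cV[R]_n) :
  (pt s *m c) 0 0 = \sum_i (s i).+1%:R * c i 0.
Proof. by rewrite mxE; apply: eq_bigr => i _; rewrite mxE. Qed.

Definition sqdist s u : R := \sum_i ((s i)%:R - (u i)%:R) ^+ 2.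

Lemma sqdistC s u : sqdist s u = sqdist u s.
Proof. by apply: eq_bigr => i _; rewrite -sqrrN opprB. Qed.

Lemma sqdist0 s : sqdist s s = 0.
Proof. by apply: big1 => i _; rewrite subrr expr0n. Qed.

Lemma sqr_nat_sub (a b : nat) : a != b -> 1 <= (a%:R - b%:R : R) ^+ 2.
Proof.
move=> ab; wlog lt : a b ab / (a < b)%N.
  move=> h; case: (ltngtP a b) => [lt|lt|e]; first exact: h.
    by rewrite -sqrrN opprB h // eq_sym.
  by rewrite e eqxx in ab.
have : a.+1%:R <= b%:R :> R by rewrite ler_nat.
rewrite -natr1; nra.
Qed.

(** Distinct permutations disagree at two arguments at least, and each disagreement contributes at
    least 1. *)
Lemma sqdist_ge2 s u : s != u -> 2 <= sqdist s u.
Proof.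
move=> su; have [i si] : exists i, s i != u i.
  apply/existsP; rewrite -negb_forall; apply: contra su => /forallP h.
  by apply/eqP/permP=> i; apply/eqP.
pose j := (s^-1)%g (u i).
have sj : s j = u i by rewrite permKV.
have ji : j != i by apply: contraNneq si => e; rewrite -sj e.
have uj : s j != u j by rewrite sj; apply: contraNneq ji => /perm_inj->.
rewrite /sqdist (bigD1 i) //= (bigD1 j) //=.
have h1 := sqr_nat_sub si; have h2 := sqr_nat_sub uj.
have h3 : 0 <= \sum_(k < n | (k != i) && (k != j)) ((s k)%:R - (u k)%:R : R) ^+ 2.
  by apply: sumr_ge0 => k _; exact: sqr_ge0.
lra.
Qed.

Definition sqnorm : R := \sum_(i < n) i.+1%:R ^+ 2.

Lemma sqnorm_perm s : \sum_i (s i).+1%:R ^+ 2 = sqnorm.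
Proof. by rewrite /sqnorm [RHS](reindex_inj (@perm_inj _ s)). Qed.

(** Polarization: all these points have squared norm [sqnorm]. *)
Lemma dot_perm_points s u : (pt u *m (pt s)^T) 0 0 = sqnorm - sqdist s u / 2.
Proof.
have -> : sqnorm = (sqnorm + sqnorm) / 2 by field.
rewrite -{1}(sqnorm_perm s) -(sqnorm_perm u) dot_perm_point /sqdist.
rewrite -big_split -mulrBl -sumrB mulr_suml; apply: eq_bigr => i _ /=.
by rewrite !mxE -!natr1; field.
Qed.

(** The points lie on a common sphere, so the functional given by [pt s] is largest at [s] alone. *)
Lemma is_vertex_perm_point s : is_vertex P (pt s).
Proof.
exists (pt s)^T, sqnorm.
have le u : (pt u *m (pt s)^T) 0 0 <= sqnorm /\
    ((pt u *m (pt s)^T) 0 0 = sqnorm -> [set pt s] (pt u)).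
  rewrite dot_perm_points; have [->|su] := eqVneq s u.
    by rewrite sqdist0; split=> //; lra.
  by have := sqdist_ge2 su; split; [lra|move=> e; exfalso; lra].
split; first by apply: conv_hull_le => _ [u _ <-]; case: (le u).
apply/seteqP; split=> x /=.
  by move=> ->; split; [exact: perm_point_in|rewrite dot_perm_points sqdist0; lra].
case=> Px xa; apply: (conv_hull_face _ _ Px xa : [set pt s] x); last first.
  by move=> _ [u _ <-]; exact: le.
by apply/convex_setP => y z t /= -> -> _ _; rewrite -scalerDl addrC subrK scale1r.
Qed.

(** The functional given by [pt s + pt u] falls short of [2 * sqnorm] by 1 at [s] and [u], and by at
    least 2 at every other permutation, since 2 is the least squared distance. *)
Lemma is_edge_perm_point s u : sqdist s u = 2 ->
  is_edge P (conv_hull [set pt s; pt u]).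
Proof.
move=> su; pose c := (pt s)^T + (pt u)^T.
have dotE v : (pt v *m c) 0 0 = 2 * sqnorm - (sqdist s v + sqdist u v) / 2.
  by rewrite mulmxDr mxE !dot_perm_points; field.
have eqs : (pt s *m c) 0 0 = 2 * sqnorm - 1 by rewrite dotE sqdist0 sqdistC su; field.
have equ : (pt u *m c) 0 0 = 2 * sqnorm - 1 by rewrite dotE sqdist0 su; field.
have cv := @convex_conv_hull R n [set pt s; pt u].
have hs : conv_hull [set pt s; pt u] (pt s) by apply: subset_conv_hull; left.
have hu : conv_hull [set pt s; pt u] (pt u) by apply: subset_conv_hull; right.
have le v : (pt v *m c) 0 0 <= 2 * sqnorm - 1 /\
    ((pt v *m c) 0 0 = 2 * sqnorm - 1 -> conv_hull [set pt s; pt u] (pt v)).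
  have [<-|sv] := eqVneq s v; first by rewrite eqs.
  have [<-|uv] := eqVneq u v; first by rewrite equ.
  have := sqdist_ge2 sv; have := sqdist_ge2 uv.
  by rewrite dotE => h1 h2; split; [lra|move=> e; exfalso; lra].
split.
  exists c, (2 * sqnorm - 1).
  split; first by apply: conv_hull_le => _ [v _ <-]; case: (le v).
  apply/seteqP; split=> x /=.
    move=> hx; split; last by apply: conv_hull_eq hx => y [|] ->.
    by move: x hx; apply: conv_hull_min => [|x [|] ->]; [exact: convex_conv_hull| |];
       exact: perm_point_in.
  by case=> Px xa; apply: (conv_hull_face _ _ Px xa) => // _ [v _ <-]; exact: le.
exists (pt s), [tuple pt u - pt s]; split=> //.
- by move=> i; rewrite ord1 tnth0 addrC subrK.
- rewrite seq1_free subr_eq0; apply/eqP => e.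
  have := dot_perm_points s u; rewrite e dot_perm_points sqdist0 su; lra.
apply: conv_hull_min; last first.
  move=> x [|] -> /=; first by rewrite subrr mem0v.
  by apply: memv_span; rewrite mem_seq1.
apply/convex_setP => x y t /= hx hy t0 t1.
have -> : t *: x + (1 - t) *: y - pt s = t *: (x - pt s) + (1 - t) *: (y - pt s).
  by rewrite !scalerBr addrACA -opprD -[t *: pt s + _]scalerDl [t + _]addrC subrK scale1r.
by rewrite rpredD // rpredZ.
Qed.

Lemma tperm_dot s (c : 'cV[R]_n) i j : i != j ->
  (pt (tperm i j * s)%g *m c) 0 0 =
  (pt s *m c) 0 0 + (c j 0 - c i 0) * ((s i)%:R - (s j)%:R).
Proof.
move=> ij; rewrite !dot_perm_point.
have ji : j != i by rewrite eq_sym.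
rewrite (bigD1 i) //= (bigD1 j) //= [in RHS](bigD1 i) //= [in RHS](bigD1 j) //=.
rewrite !permM tpermL tpermR.
under eq_bigr => k /andP[ki kj] do rewrite permM tpermD 1?eq_sym //.
by rewrite -!natr1; ring.
Qed.

Lemma card_perm_lt s m : (m <= n)%N -> #|[set i | (s i < m)%N]%SET| = m.
Proof.
move=> le; rewrite -sum1_card.
rewrite (reindex_inj (@perm_inj _ (s^-1)%g)).
rewrite (eq_bigl (fun j : 'I_n => (j < m)%N)); last by move=> j; rewrite inE permKV.
by rewrite (big_ord_narrow le) sum1_card card_ord.
Qed.

(** By counting: if [i] is in [T], all positions of value at most [s i] are in [T]; if not, all of
    [T] has values below [s i]. *)
Lemma bottom_set s T : (forall i j, i \in T -> j \notin T -> (s i < s j)%N) ->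
  T = [set i | (s i < #|T|)%N]%SET.
Proof.
move=> h; apply/setP=> i; rewrite inE; apply/idP/idP => [iT|].
  rewrite -(card_perm_lt s (ltn_ord (s i))); apply/subset_leq_card/fintype.subsetP => j.
  rewrite inE ltnS; apply: contraTT => jT; rewrite -ltnNge; exact: h.
apply: contraTT => iT; rewrite -leqNgt -[leqRHS](card_perm_lt s (ltnW (ltn_ord (s i)))).
by apply/subset_leq_card/fintype.subsetP=> j jT; rewrite inE h.
Qed.

(** [T] collects the indices where the normal [c] is smallest. By exchanging two coordinates, a
    vertex maximizing [c] has its smallest coordinates on [T]. Hence [F] lies in the face where the
    coordinates over [T] have least sum, and [facet_maximal] gives the converse inclusion. *)
Lemma facet_bottom_set F : is_facet P F -> exists T : {set 'I_n},
  [/\ exists i, i \in T, exists j, j \notin T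
    & forall s, F (pt s) <-> T = [set i | (s i < #|T|)%N]%SET].
Proof.
case=> -[c [a [le defF]]] [d [dP dF]].
have FP s : F (pt s) <-> (pt s *m c) 0 0 = a.
  by rewrite defF; split=> [[]//|e]; split=> //; exact: perm_point_in.
(* A constant normal takes a single value on [P], so the nonempty face [F] would be all of [P],
   against the dimensions. *)
have [i0 [j0 ij0]] : exists i j, c i 0 < c j 0.
  apply: contrapT => cst.
  have cE i j : c i 0 = c j 0.
    by case: (ltgtP (c i 0) (c j 0)) => // lt; case: cst; [exists i, j|exists j, i].
  have PF : P `<=` F.
    have [x0 [b [Fx _ _ _]]] := dF; move: Fx; rewrite {1}defF /= => -[Px xa] y Py.
    rewrite defF; split=> //; rewrite -xa.
    have eqP x : P x -> (x *m c) 0 0 = (pt 1%g *m c) 0 0.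
      apply: conv_hull_eq => _ [s _ <-]; rewrite !dot_perm_point.
      rewrite [RHS](reindex_inj (@perm_inj _ s)); apply: eq_bigr => i _.
      by rewrite perm1 (cE (s i) i).
    by rewrite !eqP.
  by have := has_dim_mono dP dF PF; rewrite ltnn.
pose T := [set i | [forall j, c i 0 <= c j 0]]%SET.
have ltT i j : i \in T -> j \notin T -> c i 0 < c j 0.
  rewrite !inE => /forallP hi; rewrite negb_forall => /existsP[k]; rewrite -ltNge.
  exact: le_lt_trans.
have iT : exists i, i \in T.
  have [i _ hi] := @arg_minP _ _ _ i0 predT (fun i => c i 0) isT.
  by exists i; rewrite inE; apply/forallP => j; exact: hi.
have jT : exists j, j \notin T.
  by exists j0; rewrite inE negb_forall; apply/existsP; exists i0; rewrite -ltNge.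
have bottom s : F (pt s) -> T = [set i | (s i < #|T|)%N]%SET.
  move=> /FP e; apply: bottom_set => i j hi hj; rewrite ltnNge; apply/negP => ji.
  have ij : i != j by apply: contraNneq hj => <-.
  have := le _ (perm_point_in (tperm i j * s)%g); rewrite tperm_dot // e.
  have := ltT _ _ hi hj.
  have : (s j)%:R + 1 <= (s i)%:R :> R.
    rewrite natr1 ler_nat ltn_neqAle ji andbT; apply: contra_neq ij => /val_inj/perm_inj.
    by [].
  nra.
exists T; split=> // s; split; first exact: bottom.
(* [g] sums the coordinates over [T], and [m] is the sum of the [#|T|] smallest values. *)
pose g : 'cV[R]_n := \col_i (i \in T)%:R.
pose m : R := \sum_(j < n) j.+1%:R * (j < #|T|)%:R.
have gm u : T = [set i | (u i < #|T|)%N]%SET -> (pt u *m g) 0 0 = m.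
  move=> eT; rewrite dot_perm_point /m [RHS](reindex_inj (@perm_inj _ u)).
  by apply: eq_bigr => i _; rewrite mxE {1}eT inE.
move/gm; apply: (facet_maximal defF dP dF); last exact: perm_point_in.
  move=> x; rewrite defF => -[Px]; move: x Px.
  apply: (@conv_hull_face _ _ _ [set x | (x *m g) 0 0 = m]).
    by apply/convex_setP => x y t /= hx hy t0 t1; rewrite dotD hx hy; ring.
  move=> _ [u _ <-]; split; first exact: le (perm_point_in u).
  by move/FP/bottom/gm.
(* A vertex off the hyperplane [g = m]: the identity, or else the identity with two coordinates
   exchanged across [T]. *)
have [i hi] := iT; have [j hj] := jT.
have ij : i != j by apply: contraNneq hj => <-.
have [e|ne] := eqVneq ((pt 1%g *m g) 0 0) m; last by exists (pt 1%g) => //; exact: perm_point_in.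
exists (pt (tperm i j * 1)%g); first exact: perm_point_in.
rewrite tperm_dot // e !mxE hi (negPf hj) !perm1 sub0r mulN1r -subr_eq0 addrC addKr.
by rewrite oppr_eq0 subr_eq0 eqr_nat.
Qed.

End Permutahedron.

(** * From words to the skeleton *)

Lemma next_nth_uniq (T : eqType) (x0 : T) (p : seq T) i :
  uniq p -> i.+1 < size p -> next p (nth x0 p i) = nth x0 p i.+1.
Proof.
move=> up ip; rewrite next_nth mem_nth 1?ltnW // index_uniq 1?ltnW //.
by case: p up ip => //= y p _ ip; apply: set_nth_default.
Qed.

Lemma walk_path st W w' : walk (tgt st) W w' ->
  path (fun st1 st2 => tgt st1 == src st2) st W.
Proof. by elim: W st => [|st' W IH] st //= /andP[/eqP-> /IH ->]; rewrite eqxx. Qed.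

Lemma walk_cycle w W : walk w W w -> path.cycle (fun st1 st2 => tgt st1 == src st2) W.
Proof.
case: W => //= st W /andP[/eqP <- h]; apply: (@walk_path st _ (tgt st)).
by rewrite -cats1; apply: (walk_cat h); rewrite /= !eqxx.
Qed.

Lemma index_src_tgt (A D : seq nat) (c d : nat) : uniq (A ++ c :: d :: D) ->
  [/\ index c (A ++ c :: d :: D) = size A, index d (A ++ c :: d :: D) = (size A).+1,
      index c (A ++ d :: c :: D) = (size A).+1, index d (A ++ d :: c :: D) = size A
    & forall x, x != c -> x != d -> index x (A ++ c :: d :: D) = index x (A ++ d :: c :: D)].
Proof.
rewrite cat_uniq /= !inE !negb_or => /and3P[_ /and3P[cA dA _] /and3P[/andP[cd _] _ _]].
have dc : (d == c) = false by rewrite eq_sym (negPf cd).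
rewrite !index_cat (negPf cA) (negPf dA) /= !eqxx dc (negPf cd); split; rewrite ?addn0 ?addn1 //.
move=> x xc xd; rewrite !index_cat /= (eq_sym c) (eq_sym d) (negPf xc) (negPf xd).
by [].
Qed.

Section WordPoints.
Variables (R : realType) (N : nat).
Local Open Scope ring_scope.

(** Coordinates are positions of labels, so the word lists the inverse permutation. Exchanging
    adjacent letters then exchanges two consecutive values, and prefix sets become bottom sets. *)
Definition word_point (w : seq nat) : 'rV[R]_N := \row_i (index (val i) w).+1%:R.

Lemma word_perm w : perm_eq w (iota 0 N) -> exists s : 'S_N,
  (forall i, s i = index (val i) w :> nat) /\ word_point w = perm_point R s.
Proof.
move=> pw; have mw (i : 'I_N) : val i \in w by rewrite (perm_mem pw) mem_iota /=.
have lt (i : 'I_N) : (index (val i) w < N)%N.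
  by rewrite -[X in (_ < X)%N](size_iota 0) -(perm_size pw) index_mem.
have inj : injective (fun i => Ordinal (lt i)).
  by move=> i j [] e; apply/val_inj; rewrite -(nth_index 0%N (mw i)) e nth_index //; exact: mw.
have e i : perm inj i = index (val i) w :> nat by rewrite permE.
by exists (perm inj); split=> //; apply/rowP => i; rewrite !mxE e.
Qed.

Lemma word_point_inj : {in [pred w | perm_eq w (iota 0 N)] &, injective word_point}.
Proof.
move=> w w'; rewrite !inE => pw pw' /rowP e.
have sw : size w = N by rewrite (perm_size pw) size_iota.
have sw' : size w' = N by rewrite (perm_size pw') size_iota.
apply: (@eq_from_nth _ 0%N) => [|k]; rewrite sw // => kN.
have uw : uniq w by rewrite (perm_uniq pw) iota_uniq.
have xN : (nth 0 w k < N)%N.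
  have : nth 0%N w k \in w by rewrite mem_nth ?sw.
  by rewrite (perm_mem pw) mem_iota.
have := e (Ordinal xN); rewrite !mxE => /eqP; rewrite eqr_nat eqSS /= => /eqP.
rewrite index_uniq ?sw // => ek; rewrite [in RHS]ek nth_index // (perm_mem pw') mem_iota.
exact: xN.
Qed.

Lemma wf_tgt st : wf_swap N st -> perm_eq (tgt st) (iota 0 N).
Proof. exact/perm_trans/perm_tgt. Qed.

(** The two exchanged labels move by one position each, so the squared distance is 2. *)
Lemma skeleton_swap st : wf_swap N st ->
  skeleton (@permutahedron R N) (word_point (src st)) (word_point (tgt st)).
Proof.
move=> w; have [s [sE ->]] := word_perm w; have [u [uE ->]] := word_perm (wf_tgt w).
apply/asboolP; split; [exact: is_vertex_perm_point..|apply: is_edge_perm_point].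
case: st w sE uE => [[[A c] d] D] w sE uE; have [uq mem] := wf_swapP w.
have [_ _ cd _ _] := wf_swap_neq w.
have cN : (c < N)%N by rewrite -mem mem_cat !inE eqxx ?orbT.
have dN : (d < N)%N by rewrite -mem mem_cat !inE eqxx ?orbT.
have [e1 e2 e3 e4 e5] := index_src_tgt uq.
rewrite /sqdist (bigD1 (Ordinal cN)) //= (bigD1 (Ordinal dN)) /=; last first.
  by rewrite -val_eqE /= eq_sym.
rewrite !sE !uE /= e1 e2 e3 e4 big1 => [|i /andP[]].
  by rewrite -!natr1; ring.
by rewrite -!val_eqE /= => ic id; rewrite sE uE /= e5 // subrr expr0n.
Qed.

End WordPoints.

(** * Connectedness inside a facet *)

Section MeetConnected.
Variables (R : realType) (n : nat) (F : set 'rV[R]_n) (C : seq 'rV[R]_n).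
Local Open Scope ring_scope.
Local Open Scope classical_set_scope.
Implicit Types u v w : 'rV[R]_n.

Definition joined u v : Prop := exists p, path (meet_edge F C) u p /\ last u p = v.

Lemma meet_edge_sym : symmetric (meet_edge F C).
Proof.
move=> u v; rewrite /meet_edge /= /cycle_edge /= setUC; congr (_ && _).
by rewrite andbCA orbC.
Qed.

Lemma joined_refl u : joined u u.
Proof. by exists [::]. Qed.

Lemma joined_trans u v w : joined u v -> joined v w -> joined u w.
Proof.
move=> [p [pp <-]] [q [qp <-]]; exists (p ++ q).
by rewrite cat_path pp qp last_cat.
Qed.

Lemma joined_edge u v : meet_edge F C u v -> joined u v.
Proof. by move=> uv; exists [:: v]; rewrite /= andbT. Qed.

Lemma joined_sym u v : joined u v -> joined v u.
Proof.
case=> p [+ <-]; elim: p u => [|x p IH] u /=; first by move=> _; exact: joined_refl.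
by case/andP=> ux /IH h; apply: (joined_trans h); apply: joined_edge; rewrite meet_edge_sym.
Qed.

End MeetConnected.

Section FullCycle.
Variables (R : realType) (n : nat) (w : seq nat) (W : seq swap).
Hypotheses (cW : full_cycle n w W) (pw : perm_eq w (iota 0 n.+2)).
Local Open Scope classical_set_scope.

Local Notation pt := (@word_point R n.+2).
Local Notation C := (map (pt \o tgt) W).

Let wf : all (wf_swap n.+2) W. Proof. by case: cW. Qed.

Lemma uniq_full_cycle : uniq C.
Proof.
rewrite map_comp map_inj_in_uniq; first exact: full_cycle_uniq cW pw.
by move=> _ _ /mapP[st1 h1 ->] /mapP[st2 h2 ->]; apply: word_point_inj;
   rewrite inE; apply/wf_tgt/(allP wf).
Qed.

Lemma skeleton_full_cycle : ucycle (skeleton (@permutahedron R n.+2)) C.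
Proof.
rewrite /ucycle uniq_full_cycle andbT cycle_map.
have [/walk_cycle + _ _ _ _] := cW.
apply: (sub_in_cycle _ wf) => st1 st2 _ wst2 /= /eqP e.
by rewrite e; exact: skeleton_swap.
Qed.

(** The words in [F] are those having [T] as prefix set. Only the step [st0] makes this set, so
    these words form one interval of the cycle, starting at [tgt st0]. *)
Lemma facet_full_cycle F : is_facet (@permutahedron R n.+2) F ->
  meet_nonempty F C /\ meet_connected F C.
Proof.
move=> fF; have cF : @convex_set R 'rV[R]_n.+2 F.
  by apply: is_face_convex fF.1; exact: convex_conv_hull.
have [T [[i iT] [j jT] FT]] := facet_bottom_set fF.
pose s := map val (enum T); pose X := bits n.+2 s; pose k := #|T|.
have us : uniq s by rewrite map_inj_uniq ?enum_uniq //; exact: val_inj.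
have bs x : x \in s -> x < n.+2 by case/mapP=> y _ ->; exact: ltn_ord.
have sk : size s = k by rewrite size_map -cardE.
have ms (x : 'I_n.+2) : (val x \in s) = (x \in T).
  by rewrite mem_map ?mem_enum //; exact: val_inj.
have FX v : perm_eq v (iota 0 n.+2) -> F (pt v) <-> bits n.+2 (take k v) = X.
  move=> pv; have [u [uE ->]] := word_perm R pv; rewrite FT.
  have mt (x : 'I_n.+2) : (val x \in take k v) = (u x < k).
    by rewrite in_take ?uE // (perm_mem pv) mem_iota /=.
  split=> [eT|/eq_bits e].
    by apply/eq_bits => x lx; have := mt (Ordinal lx) => /= ->; rewrite (ms (Ordinal lx)) eT inE.
  by apply/setP => x; rewrite [in RHS]inE -/k -mt -ms e //; exact: ltn_ord.
have [_ _ _ cnt _] := cW.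
have pX : (true \in X) && (false \in X).
  have := mem_bits s (ltn_ord i : val i < _); have := mem_bits s (ltn_ord j : val j < _).
  by rewrite !ms iT (negPf jT) => -> ->.
have /hasP[st0 stW st0X] := full_cycle_level cW (size_bits _ _) pX.
have [W1 [W2 eW]] : exists W1 W2, W = W1 ++ st0 :: W2.
  by case/splitPr: stW => W1 W2; exists W1, W2.
(* The cycle rotated so as to start with [st0]. *)
pose V := st0 :: W2 ++ W1.
have rV : map (pt \o tgt) V = rot (size W1) C.
  by rewrite eW map_cat -(size_map (pt \o tgt)) rot_size_cat -map_cat.
have pV : perm_eq V W by rewrite eW perm_sym perm_catC.
have other st : st \in W2 ++ W1 -> bits n.+2 (made st) != X.
  move=> h; apply/negP => stX.
  have : 0 < count (makes n.+2 X) (W2 ++ W1) by rewrite -has_count; apply/hasP; exists st.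
  by have := cnt X (size_bits _ _); rewrite -(seq.permP pV) /= st0X pX add1n => -[->]; rewrite ltnn.
have chain : path (fun st1 st2 => tgt st1 == src st2) st0 (W2 ++ W1).
  have [/walk_cycle + _ _ _ _] := cW; rewrite {1}eW cycle_catC /=.
  by rewrite rcons_path => /andP[].
pose S m := nth st0 V m.
have SW m : m < size V -> S m \in W by rewrite -(perm_mem pV); exact: mem_nth.
have wS m : m < size V -> wf_swap n.+2 (S m) by move=> /SW /(allP wf).
have F0 : F (pt (tgt st0)).
  have [um bm _] := wf_made (allP wf _ stW).
  apply/FX; first exact/wf_tgt/(allP wf).
  rewrite -sk -(eq_bits_size um us bm bs (eqP st0X)) take_tgt; exact/eqP.
have CS m : m < size V -> pt (tgt (S m)) \in C.
  by move=> /SW Sm; apply/mapP; exists (S m).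
have join m : m < size V -> F (pt (tgt (S m))) -> joined F C (pt (tgt st0)) (pt (tgt (S m))).
  elim: m => [|m IH] lm Fm; first exact: joined_refl.
  have link : tgt (S m) = src (S m.+1) by move/(pathP st0): chain => /(_ m lm)/eqP.
  (* The step [S m.+1] does not make [X]: since its target has that prefix set, so has its
     source. *)
  have Fm' : F (pt (tgt (S m))).
    apply/FX; first exact/wf_tgt/wS/ltnW.
    move: Fm => /FX -/(_ (wf_tgt (wS _ lm))) e; rewrite -e link.
    apply/eq_bits => x _; rewrite mem_take_tgt //.
    have : bits n.+2 (made (S m.+1)) != X by apply: other; exact: mem_nth.
    by apply: contraNneq => km; rewrite -e -km take_tgt.
  apply: (joined_trans (IH (ltnW lm) Fm')); apply: joined_edge.
  have Cm := CS m (ltnW lm); have Cm1 := CS m.+1 lm.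
  have nx : next C (pt (tgt (S m))) = pt (tgt (S m.+1)).
    rewrite -(next_rot (size W1)) ?uniq_full_cycle // -rV.
    have := @next_nth_uniq _ (pt (tgt st0)) (map (pt \o tgt) V) m.
    rewrite size_map (nth_map st0 _ _ (ltnW lm)) (nth_map st0 _ _ lm); apply=> //.
    by rewrite rV rot_uniq uniq_full_cycle.
  apply/andP; split; first by apply/and3P; split=> //; apply/orP; left; rewrite nx.
  by apply/asboolP; apply: conv_hull_min => // x [|] ->.
have join' v : meet_vertex F C v -> joined F C (pt (tgt st0)) v.
  case=> /mapP[st stW' ->] /= Fst.
  have stV : st \in V by rewrite (perm_mem pV).
  by have := join (index st V); rewrite /S nth_index // index_mem; apply.
split; first by exists (pt (tgt st0)); split=> //; exact: (CS 0).
by move=> u v /join' hu /join' hv; exact: joined_trans (joined_sym hu) hv.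
Qed.

End FullCycle.

Theorem theorem1p3 (R : realType) (n : nat) (hn : (3 <= n)%N) :
  exists C : seq 'rV[R]_n, facet_hamiltonian (@permutahedron R n) C.
Proof.
case: n hn => [|[|n]] // hn; have [w [W [cW sW]]] := full_cycle_exists n.
have pw : perm_eq w (iota 0 n.+2).
  case: W cW sW => // st W [/= /andP[/eqP <- _] /andP[wst _] _ _ _] _.
  exact: wst.
exists (map (@word_point R n.+2 \o tgt) W); split; last exact: facet_full_cycle cW pw.
split; first by rewrite size_map (leq_trans hn).
exact: skeleton_full_cycle cW pw.
Qed.
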